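(* There is a $64\,T\to2\,CCZ$ distillation protocol of distance $4$ whose leading-order probability of any output error is $2720p^4$. Precisely, let $\mathcal D\subset\mathbb F_{16}^2$ be the set of points $(x,y)$ with $y^4+y=x^5$ (so $|\mathcal D|=64$), let $\mathbb F_{16}=\mathbb F_2(\alpha)$ with $\alpha^4=\alpha+1$, and let $(\beta_1,\beta_2,\beta_3,\beta_4)=(\alpha^3,\alpha^{12},\alpha^7,\alpha^{13})$, a self-dual basis of $\mathbb F_{16}$ over $\mathbb F_2$. Let $G$ be the binary matrix with columns indexed by $\mathcal D$ whose six logical rows are the evaluations on $\mathcal D$ of $$\mathrm{tr}(\beta_1x^3),\ \mathrm{tr}(\beta_2x^3),\ \mathrm{tr}(\beta_1xy),\ \mathrm{tr}(\beta_2xy),\ \mathrm{tr}(\beta_3xy),\ \mathrm{tr}(\beta_4xy),$$ and whose nine stabilizer rows are the evaluations of $1$, $\mathrm{tr}(\beta_ix)$ and $\mathrm{tr}(\beta_iy)$, $1\le i\le4$. Then: (1) $G$ has full rank, and $D_G=C\,(V\otimes I)$ for some diagonal Clifford unitary $C$ on $15$ qubits and some unitary $V$ on the six logical qubits which is Clifford equivalent to two $CCZ$ gates acting on disjoint triples of qubits. (2) The $Z$-distance of the corresponding CSS code is $4$, and the number of weight-4 vectors in $\mathbb F_2^{64}$ that are orthogonal to all stabilizer rows but not to all logical rows is $2720$.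
   Context: $T=\mathrm{diag}(1,e^{i\pi/4})$; $\mathrm{tr}$ is the trace $\mathbb F_{16}\to\mathbb F_2$. A full-rank binary matrix $G\in\mathbb F_2^{m\times n}$ with $k$ logical rows defines a CSS code on $n$ qubits: the first $k$ rows are $X$-logical operators, the last $m-k$ rows are $X$-stabilizer generators. Its $Z$-distance is the minimum Hamming weight of a vector in $\mathbb F_2^n$ orthogonal to all stabilizer rows but not to at least one logical row; vectors with this property are the undetected nontrivial $Z$ errors, so if each input suffers an independent $Z$ error with probability $p$, the leading-order probability of any accepted output error is (number of such vectors of minimum weight $d$)$\cdot p^d$. The unitary on $m$ qubits (one per row) induced by applying $T$ to every physical qubit is $D_G|z\rangle=\exp\!\big(\tfrac{i\pi}{4}\mathrm{wt}(\sum_az_a\mathbf g_a)\big)|z\rangle$, $z\in\mathbb F_2^m$, with $\mathrm{wt}$ the Hamming weight and the row sum taken mod 2. Unitaries $U,V$ are Clifford equivalent if $U=C_1VC_2$ for Clifford unitaries $C_1,C_2$. *)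

(* Defs.v *)
From HB Require Import structures.
From mathcomp Require Import all_boot all_order all_fingroup all_algebra all_solvable all_field.
From mathcomp Require Import complex.
From mathcomp Require Import reals trigo.

Set Implicit Arguments.
Unset Strict Implicit.
Unset Printing Implicit Defensive.

Import Order.TTheory GRing.Theory Num.Theory.
Local Open Scope sesquilinear_scope.
Local Open Scope ring_scope.

Definition wt n (v : 'rV['F_2]_n) : nat := #|[set i | v 0 i != 0]|.

(* The first k rows of G are the X-logical operators, the last s rows the     *)
(* X-stabilizer generators.                                                   *)
Section CSS.
Variables (k s n : nat) (G : 'M['F_2]_(k + s, n)).

Definition undetected (e : 'rV['F_2]_n) : bool :=
  (dsubmx G *m e^T == 0) && (usubmx G *m e^T != 0).

Definition Zdistance (d : nat) : Prop :=
  (exists2 e, undetected e & wt e = d)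
  /\ (forall e, undetected e -> (d <= wt e)%N).

End CSS.

(* Operators on m qubits are matrices whose rows and columns are indexed,     *)
(* through enum_val, by the computational basis |z>, z in F_2^m.              *)
Section Qubits.
Variable R : realType.

Definition expi (t : R) : R[i] := Complex (cos t) (sin t).

Definition op (m : nat) := 'M[R[i]]_#|{: 'rV['F_2]_m}|.

Definition diag_op m (f : 'rV['F_2]_m -> R[i]) : op m :=
  diag_mx (\row_i f (enum_val i)).

Definition tens_op m1 m2 (A : op m1) (B : op m2) : op (m1 + m2) :=
  \matrix_(i, j)
    (A (enum_rank (lsubmx (enum_val i))) (enum_rank (lsubmx (enum_val j)))
     * B (enum_rank (rsubmx (enum_val i))) (enum_rank (rsubmx (enum_val j)))).

(* X^a |z> = |z + a>  and  Z^b |z> = (-1)^(b . z) |z> *)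
Definition pauliX m (a : 'rV['F_2]_m) : op m :=
  \matrix_(i, j) (enum_val i == enum_val j + a)%:R.

Definition pauliZ m (b : 'rV['F_2]_m) : op m :=
  diag_op (fun z => (-1) ^+ (\sum_i b 0 i * z 0 i : 'F_2)%R).

Definition pauli m (P : op m) : Prop :=
  exists (t : nat) (a b : 'rV['F_2]_m),
    P = 'i ^+ t *: (pauliX a *m pauliZ b).

Definition clifford m (U : op m) : Prop :=
  U \is unitarymx /\ forall P : op m, pauli P -> pauli (U *m P *m U ^t*).

Definition clifford_equiv m (U V : op m) : Prop :=
  exists C1 C2 : op m, [/\ clifford C1, clifford C2 & U = C1 *m V *m C2].

Definition CCZ m (a b c : 'I_m) : op m :=
  diag_op (fun z => (-1) ^+ (z 0 a * z 0 b * z 0 c : 'F_2)%R).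

(* The unitary induced by T = diag(1, e^(i pi/4)) on every physical qubit *)
Definition induced_T m n (G : 'M['F_2]_(m, n)) : op m :=
  diag_op (fun z => expi (pi / 4%:R * (wt (z *m G))%:R)).

End Qubits.

(* finvect_type F is F itself, equipped with its finite field structure. *)
Section Code.
Variable F : fieldExtType 'F_2.
Local Notation L := (finvect_type F).

(* The trace L -> F_2. galTrace takes its values in the prime subfield {0, 1} *)
(* of L, which is identified here with 'F_2: see trE.                         *)
Definition tr (z : L) : 'F_2 := (galTrace 1 {:L} z != 0)%:R.

Lemma trE (z : L) : (tr z)%:A = galTrace 1 {:L} z.
Proof.
have galL : galois 1 {:L} := finField_galois (sub1v {:L}).
rewrite /tr; have /vlineP[c ->] := mem_galTrace galL (memvf z).
rewrite scaler_eq0 oner_eq0 orbF.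
by case: c => [[|[|//]] ?]; congr (_ *: _); apply: val_inj.
Qed.

Lemma galTrace_Frobenius (z : L) :
  galTrace 1 {:L} z = \sum_(i < \dim {:F}) z ^+ (2 ^ i).
Proof.
have [g /eqP genL gE] := finField_galois_generator (sub1v {:L}).
have ordg : #[g]%g = \dim {:F}.
  have galL : galois 1 {:L} := finField_galois (sub1v {:L}).
  by rewrite /order -genL -(galois_dim galL) dimv1 divn1.
have gXE k : (g ^+ k)%g z = z ^+ (2 ^ k).
  elim: k => [|k IHk]; first by rewrite expg0 gal_id expr1.
  rewrite expgSr galM ?memvf // IHk gE ?memvf // dimv1 expn1 card_Fp //.
  by rewrite -exprM -expnSr.
have genE : <[g]>%g = [set (g ^+ val i)%g | i : 'I_(#[g]%g)].
  apply/setP=> h; apply/idP/imsetP => [/cyclePmin[i lti ->] | [i _ ->]].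
    by exists (Ordinal lti).
  exact: mem_cycle.
rewrite /galTrace genL genE big_imset /=; last first.
  move=> i j _ _ /eqP; rewrite eq_expg_mod_order !modn_small //.
  by move/eqP/val_inj.
rewrite -ordg; apply: eq_bigr => i _; exact: gXE.
Qed.

Definition curve : {set L * L} :=
  [set P | P.2 ^+ 4 + P.2 == P.1 ^+ 5].

Variable alpha : L.

Definition beta : seq L :=
  [:: alpha ^+ 3; alpha ^+ 12; alpha ^+ 7; alpha ^+ 13].

Definition self_dual_basis (b : seq L) : Prop :=
  basis_of {:L} b
  /\ forall i j, (i < size b)%N -> (j < size b)%N ->
       tr (b`_i * b`_j) = (i == j)%:R.

Definition logical_evals (P : L * L) : seq 'F_2 :=
  let: (x, y) := P in
  [:: tr (beta`_0 * x ^+ 3); tr (beta`_1 * x ^+ 3);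
      tr (beta`_0 * (x * y)); tr (beta`_1 * (x * y));
      tr (beta`_2 * (x * y)); tr (beta`_3 * (x * y))].

Definition stabilizer_evals (P : L * L) : seq 'F_2 :=
  let: (x, y) := P in
  [:: 1;
      tr (beta`_0 * x); tr (beta`_1 * x); tr (beta`_2 * x); tr (beta`_3 * x);
      tr (beta`_0 * y); tr (beta`_1 * y); tr (beta`_2 * y); tr (beta`_3 * y)].

Definition code_matrix : 'M['F_2]_(6 + 9, #|curve|) :=
  col_mx (\matrix_(i, j) (logical_evals (enum_val j))`_i)
         (\matrix_(i, j) (stabilizer_evals (enum_val j))`_i).

End Code.

(* Main.v *)
Require Import Defs.
From mathcomp Require Import all_boot all_order all_fingroup all_algebra all_solvable all_field.
From mathcomp Require Import complex.
From mathcomp Require Import reals trigo.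
From mathcomp Require Import ring zify.

(* Writing F_16 as F_2[t]/(t^4 + t + 1) turns every statement about the     *)
(* matrix into a finite computation on its 64 columns.                        *)
(*   Modulo 8, wt(z G) = sum_a |g_a| z_a - 2 sum_{a<b} |g_a g_b| z_a z_b      *)
(*                       + 4 sum_{a<b<c} |g_a g_b g_c| z_a z_b z_c.           *)
(* All |g_a| and |g_a g_b| are even, so the first two sums only contribute S  *)
(* and CZ gates, and |g_a g_b g_c| is odd only for ten logical triples.  The  *)
(* resulting alternating trilinear form on F_2^6 is the sum of two            *)
(* decomposable ones, so in suitable coordinates y = z A the cubic phase is   *)
(* y0 y1 y2 + y3 y4 y5 + (z0 z4 + z1 z5), i.e. two CCZ gates up to two CZ.    *)
(*   The undetected errors of weight w are the sets of w columns whose sum    *)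
(* vanishes on the stabilizer rows but not on the logical rows.               *)

Set Implicit Arguments.
Unset Strict Implicit.
Unset Printing Implicit Defensive.

Import Order.TTheory GRing.Theory Num.Theory.
Local Open Scope sesquilinear_scope.
Local Open Scope ring_scope.

(** * The Hermitian curve over F_16 *)

(** Both claims depend on [G] only up to a permutation of its 64 columns. Evaluation at [alpha] is a
    bijection from the model [gf16] preserving sums and products, so [code_matrix_columns] replaces
    these columns by an explicit list of bit vectors. For (1), [wt_mod8] makes the exponent of [D_G]
    a cubic polynomial in the bits of z. A diagonal phase that every shift z + a multiplies by a
    Pauli phase is Clifford ([quadratic_phase_clifford]). S and CZ phases are of this kind, and the
    parity tables show that the linear and quadratic terms yield only such phases. The cubic terms
    involve logical bits only, and [cubic_normal_form] turns them into y0 y1 y2 + y3 y4 y5, up to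
    quadratic terms, by an invertible change y = z A. This change permutes the basis states and is
    Clifford ([linear_op_clifford]), so [V], the phase of the two cubic monomials in y, is
    equivalent to two CCZ gates. The quotient of [D_G] by [V] is the Clifford [C]
    ([correction_quadratic]). For (2), errors over F_2 are sets of columns, and [card_undetected]
    reduces the count to an enumeration that is evaluated: 635376 subsets in weight 4. *)

Definition gf16 : Type := bool * bool * bool * bool.

Definition gf_add (u v : gf16) : gf16 :=
  let: (a0, a1, a2, a3) := u in let: (b0, b1, b2, b3) := v in
  (a0 (+) b0, a1 (+) b1, a2 (+) b2, a3 (+) b3).

(** [c4], [c5], [c6] are the coefficients of t^4, t^5, t^6 in the product, reduced by t^4 = t + 1,
    t^5 = t^2 + t and t^6 = t^3 + t^2. *)
Definition gf_mul (u v : gf16) : gf16 :=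
  let: (a0, a1, a2, a3) := u in let: (b0, b1, b2, b3) := v in
  let c4 := (a1 && b3) (+) (a2 && b2) (+) (a3 && b1) in
  let c5 := (a2 && b3) (+) (a3 && b2) in
  let c6 := a3 && b3 in
  ((a0 && b0) (+) c4,
   (a0 && b1) (+) (a1 && b0) (+) c4 (+) c5,
   (a0 && b2) (+) (a1 && b1) (+) (a2 && b0) (+) c5 (+) c6,
   (a0 && b3) (+) (a1 && b2) (+) (a2 && b1) (+) (a3 && b0) (+) c6).

Definition gf0 : gf16 := (false, false, false, false).
Definition gf1 : gf16 := (true, false, false, false).
Definition gf_alpha : gf16 := (false, true, false, false).

Definition gf_exp (u : gf16) (n : nat) : gf16 := iter n (gf_mul u) gf1.

Definition gf_tr (u : gf16) : bool :=
  gf_add (gf_add u (gf_exp u 2)) (gf_add (gf_exp u 4) (gf_exp u 8)) != gf0.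

Definition gf_elements : seq gf16 :=
  [seq (c, d) | c <- [seq (b, c) | b <- [seq (a, b) | a <- [:: true; false],
    b <- [:: true; false]], c <- [:: true; false]], d <- [:: true; false]].

Definition gf_curve : seq (gf16 * gf16) :=
  [seq P <- [seq (x, y) | x <- gf_elements, y <- gf_elements]
     | gf_add (gf_exp P.2 4) P.2 == gf_exp P.1 5].

Definition gf_beta : seq gf16 := [seq gf_exp gf_alpha n | n <- [:: 3; 12; 7; 13]].

Definition gf_column (P : gf16 * gf16) : seq bool :=
  let: (x, y) := P in
  [seq gf_tr (gf_mul b (gf_exp x 3)) | b <- take 2 gf_beta]
  ++ [seq gf_tr (gf_mul b (gf_mul x y)) | b <- gf_beta]
  ++ true :: [seq gf_tr (gf_mul b x) | b <- gf_beta]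
  ++ [seq gf_tr (gf_mul b y) | b <- gf_beta].

Lemma mem_gf_elements u : u \in gf_elements.
Proof. by case: u => [[[[] []] []] []]. Qed.

Lemma gf_inverse u : u != gf0 -> exists v, gf_mul u v = gf1.
Proof.
move=> u0; suff /hasP[v _ /eqP]: has (fun v => gf_mul u v == gf1) gf_elements.
  by exists v.
by move: u0; case: u => [[[[] []] []] []].
Qed.

Section Evaluation.
Variables (K : fieldType) (alpha : K).
Hypotheses (charK : 2%:R = 0 :> K) (alphaE : alpha ^+ 4 = alpha + 1).

Definition gf_eval (u : gf16) : K :=
  let: (a, b, c, d) := u in
  a%:R + b%:R * alpha + c%:R * alpha ^+ 2 + d%:R * alpha ^+ 3.

Lemma natr_addb (a b : bool) : (a (+) b)%:R = a%:R + b%:R :> K.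
Proof. by case: a; case: b; rewrite /= ?add0r ?addr0 // -natrD charK. Qed.

Lemma natr_andb (a b : bool) : (a && b)%:R = a%:R * b%:R :> K.
Proof. by rewrite -mulnb natrM. Qed.

Lemma gf_eval_add u v : gf_eval (gf_add u v) = gf_eval u + gf_eval v.
Proof.
case: u => [[[a0 a1] a2] a3]; case: v => [[[b0 b1] b2] b3] /=.
by rewrite !natr_addb; ring.
Qed.

Lemma gf_eval_mul u v : gf_eval (gf_mul u v) = gf_eval u * gf_eval v.
Proof.
case: u => [[[a0 a1] a2] a3]; case: v => [[[b0 b1] b2] b3] /=.
by rewrite !natr_addb !natr_andb; ring: alphaE.
Qed.

Lemma gf_eval0 : gf_eval gf0 = 0.
Proof. by rewrite /= !mul0r !addr0. Qed.

Lemma gf_eval1 : gf_eval gf1 = 1.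
Proof. by rewrite /= !mul0r !addr0. Qed.

Lemma gf_eval_alpha : gf_eval gf_alpha = alpha.
Proof. by rewrite /= !mul0r !addr0 mul1r add0r. Qed.

Lemma gf_eval_exp u n : gf_eval (gf_exp u n) = gf_eval u ^+ n.
Proof.
elim: n => [|n IHn]; first by rewrite gf_eval1.
by rewrite /gf_exp iterS gf_eval_mul IHn exprS.
Qed.

(** A nonzero [u] has an inverse in the model, and evaluating u v = 1 shows that the value of [u]
    cannot vanish. *)
Lemma gf_eval_eq0 u : (gf_eval u == 0) = (u == gf0).
Proof.
apply/eqP/eqP => [u0 | ->]; last exact: gf_eval0.
apply/eqP; apply: contraT => /gf_inverse[v uv1].
by have := oner_neq0 K; rewrite -gf_eval1 -uv1 gf_eval_mul u0 mul0r eqxx.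
Qed.

Lemma gf_eval_inj : injective gf_eval.
Proof.
move=> u v uv.
have: gf_eval (gf_add u v) == 0.
  by rewrite gf_eval_add uv -mulr2n -mulr_natl charK mul0r.
rewrite gf_eval_eq0; move: u v {uv} => [[[a0 a1] a2] a3] [[[b0 b1] b2] b3].
move/eqP=> [] /negbT; rewrite negb_add => /eqP-> /negbT; rewrite negb_add => /eqP->.
by move=> /negbT; rewrite negb_add => /eqP-> /negbT; rewrite negb_add => /eqP->.
Qed.

Lemma gf_eval_beta : [seq gf_eval u | u <- gf_beta]
  = [:: alpha ^+ 3; alpha ^+ 12; alpha ^+ 7; alpha ^+ 13].
Proof.
rewrite /gf_beta -map_comp (eq_map (g := fun n => alpha ^+ n)) // => n.
by rewrite /comp gf_eval_exp gf_eval_alpha.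
Qed.

End Evaluation.

Lemma perm_map_lift (T U : eqType) (f : T -> U) s t :
  perm_eq t [seq f x | x <- s] -> exists2 p, perm_eq p s & t = [seq f x | x <- p].
Proof.
case: s => [|x0 s]; first by move/perm_nilP->; exists [::].
move=> /(perm_iotaP (f x0))[r rE ->]; exists [seq nth x0 (x0 :: s) i | i <- r].
  rewrite -[X in perm_eq _ X](mkseq_nth x0) perm_map //.
  by rewrite size_map in rE.
rewrite -map_comp; apply/eq_in_map => i; rewrite (perm_mem rE) mem_iota size_map.
exact: nth_map.
Qed.

Section Curve.
Variables (F : fieldExtType 'F_2) (alpha : finvect_type F).
Hypotheses (dimF : \dim {: F} = 4%N) (alphaE : alpha ^+ 4 = alpha + 1).
Local Notation L := (finvect_type F).
Local Notation ev := (gf_eval alpha).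

Lemma two_eq0 : 2%:R = 0 :> L.
Proof.
have: 2%:R = 0 :> 'F_2 by apply: val_inj.
by move/(congr1 (fun c => c *: (1 : L))); rewrite scaler_nat scale0r.
Qed.
Local Notation char2 := two_eq0.

Lemma gf_eval_bij : bijective ev.
Proof.
apply: inj_card_bij; first exact: gf_eval_inj char2 alphaE.
have -> : #|L| = (#|'F_2| ^ \dim {: F})%N
  by rewrite -(card_vspace {: L}); apply/esym/eq_card => x; rewrite memvf.
by rewrite dimF card_Fp // !card_prod card_bool.
Qed.

Lemma tr_gf_eval u : tr (ev u) = (gf_tr u)%:R.
Proof.
rewrite /tr galTrace_Frobenius dimF !big_ord_recl big_ord0 addr0.
rewrite -!(gf_eval_exp char2 alphaE) -!(gf_eval_add alpha char2).
rewrite (gf_eval_eq0 char2 alphaE) /gf_tr.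
(* The two sides bracket the four Frobenius powers differently; the 16 elements are checked one by
   one. *)
by congr (_%:R); move: u => [[[[] []] []] []].
Qed.

Lemma beta_gf_eval i : (i < 4)%N -> (beta alpha)`_i = ev (nth gf0 gf_beta i).
Proof.
move=> i4; rewrite /beta -(gf_eval_beta char2 alphaE).
by rewrite (nth_map gf0) // size_map.
Qed.

Lemma beta_self_dual : self_dual_basis (beta alpha).
Proof.
split; last first.
  move=> i j i4 j4; rewrite !beta_gf_eval // -(gf_eval_mul char2 alphaE) tr_gf_eval.
  by congr (_%:R); move: i j i4 j4; do 4?case=> [|//]; do 4?case=> [|//].
rewrite basisEdim /= [X in (_ <= X)%N](_ : _ = 4%N) // andbT.
apply/subvP=> z _; have [inv _ invK] := gf_eval_bij; rewrite -(invK z).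
move: (inv z) => u.
(* Expansion in a self-dual basis: the coordinates of u are the traces of beta_i u. Checked on all
   16 elements, this gives spanning, and a spanning family of 4 vectors in dimension 4 is a
   basis. *)
have -> : ev u = \sum_(i < 4) (gf_tr (gf_mul (nth gf0 gf_beta i) u))%:R *: (beta alpha)`_i.
  rewrite (eq_bigr (fun i : 'I_4 => ev (if gf_tr (gf_mul (nth gf0 gf_beta i) u)
    then nth gf0 gf_beta i else gf0))); last first.
    move=> i _; rewrite beta_gf_eval //.
    by case: gf_tr; rewrite ?scale1r // scale0r gf_eval0.
  rewrite !big_ord_recl big_ord0 addr0 -!(gf_eval_add alpha char2); congr (gf_eval _ _).
  by move: u => [[[[] []] []] []].
by apply: rpred_sum => i _; apply: rpredZ; apply: memv_span; apply: mem_nth.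
Qed.

Lemma curve_column (i : 'I_(6 + 9)) (j : 'I_#|curve F|) u v :
  enum_val j = (ev u, ev v) ->
  code_matrix alpha i j = (nth false (gf_column (u, v)) i)%:R.
Proof.
move=> jE.
have nth_tr (s : seq 'F_2) (b : seq bool) k : s = [seq (x%:R : 'F_2) | x : bool <- b] ->
    s`_k = (nth false b k)%:R.
  move=> ->; have [kb|bk] := ltnP k (size b); first by rewrite (nth_map false).
  by rewrite !nth_default ?size_map.
have e k w : (k < 4)%N ->
    tr ((beta alpha)`_k * ev w) = (gf_tr (gf_mul (nth gf0 gf_beta k) w))%:R.
  by move=> k4; rewrite beta_gf_eval // -(gf_eval_mul char2 alphaE) tr_gf_eval.
rewrite /code_matrix mxE; case: splitP => k ik; rewrite mxE jE.
  rewrite (nth_tr _ (take 6 (gf_column (u, v)))) ?nth_take ?ik //.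
  by rewrite /logical_evals -!(gf_eval_exp char2 alphaE) -!(gf_eval_mul char2 alphaE) !e.
rewrite ik (nth_tr _ (drop 6 (gf_column (u, v)))) ?nth_drop //.
by rewrite /stabilizer_evals !e.
Qed.

Lemma mem_gf_curve u v : ((u, v) \in gf_curve) = ((ev u, ev v) \in curve F).
Proof.
rewrite mem_filter allpairs_f ?mem_gf_elements // andbT /curve inE /=.
rewrite -!(gf_eval_exp char2 alphaE) -(gf_eval_add alpha char2).
by rewrite (inj_eq (gf_eval_inj char2 alphaE)).
Qed.

(** The enumeration order of [curve F] is opaque, so the columns agree with the computed list only
    after a reordering [p], which affects neither weights nor counts of errors. *)
Lemma code_matrix_columns :
  exists2 p : seq 'I_#|curve F|, perm_eq p (enum 'I_#|curve F|)
  & exists2 c : 'I_#|curve F| -> seq bool,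
      [seq c j | j <- p] = [seq gf_column P | P <- gf_curve]
    & forall i j, code_matrix alpha i j = (nth false (c j) i)%:R.
Proof.
have [inv evK invK] := gf_eval_bij.
pose dec (P : L * L) := (inv P.1, inv P.2).
pose pt (j : 'I_#|curve F|) := dec (enum_val j).
have ptE j : enum_val j = (ev (pt j).1, ev (pt j).2).
  by rewrite !invK; case: (enum_val j).
have pt_inj : injective pt.
  by move=> i j ij; apply: enum_val_inj; rewrite !ptE ij.
have pt_perm : perm_eq gf_curve [seq pt j | j <- enum 'I_#|curve F|].
  apply: uniq_perm; first by vm_compute.
    by rewrite map_inj_uniq ?enum_uniq.
  move=> [u v]; rewrite mem_gf_curve; apply/idP/mapP => [uvC | [j _ uvj]].
    exists (enum_rank_in uvC (ev u, ev v)); first by rewrite mem_enum.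
    by rewrite /pt enum_rankK_in // /dec !evK.
  by have:= ptE j; rewrite -uvj => <-; apply: enum_valP.
have [p pE ptp] : exists2 p, perm_eq p (enum 'I_#|curve F|) & gf_curve = [seq pt j | j <- p].
  exact: perm_map_lift.
exists p; [exact: pE | exists (gf_column \o pt)].
  exact: etrans (map_comp _ _ _) (congr1 (map gf_column) (esym ptp)).
by move=> i j; rewrite (curve_column i (ptE j)) -surjective_pairing.
Qed.

Lemma card_curve : #|curve F| = 64%N.
Proof.
have [p pE [c pc _]] := code_matrix_columns.
have := perm_size pE; rewrite -cardE card_ord => <-.
rewrite -(size_map c) pc size_map; by vm_compute.
Qed.

End Curve.

(** * Counting subsets of columns *)

Fixpoint seq_xor (u v : seq bool) : seq bool :=
  match u, v with
  | [::], _ => v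
  | _, [::] => u
  | a :: u', b :: v' => a (+) b :: seq_xor u' v'
  end.

Lemma nth_seq_xor u v i :
  nth false (seq_xor u v) i = nth false u i (+) nth false v i.
Proof.
elim: u v i => [|a u IHu] [|b v] [|i] //=; by rewrite ?addbF //.
Qed.

Section CountSubsets.
Variable accept : (nat -> bool) -> bool.

(** The accumulator [a] is the sum of the columns chosen so far, so no list of subsets is ever
    built. Columns are read through [nth false], which makes [[::]] a zero vector of any length. *)
Fixpoint count_subsets (s : seq (seq bool)) (k : nat) (a : seq bool) : nat :=
  match k, s with
  | 0, _ => accept (nth false a)
  | _.+1, [::] => 0
  | k'.+1, x :: s' => (count_subsets s' k' (seq_xor a x) + count_subsets s' k a)%N
  end.

Hypothesis accept_ext : forall f g, f =1 g -> accept f = accept g.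

(** Pascal's recursion: the subsets containing the head x correspond to subsets of the tail through
    [x |: S], with [c x] moved into the accumulator; the others are subsets of the tail. *)
Lemma card_subsets (T : finType) (c : T -> seq bool) (p : seq T) k a :
  uniq p ->
  #|[set S : {set T} | [&& S \subset p, #|S| == k & accept (fun i =>
       nth false a i (+) \big[addb/false]_(j in S) nth false (c j) i)]]|
    = count_subsets [seq c x | x <- p] k a.
Proof.
have card0 (q : seq T) b : #|[set S : {set T} | [&& S \subset q, #|S| == 0 & accept (fun i =>
       nth false b i (+) \big[addb/false]_(j in S) nth false (c j) i)]]|
    = accept (nth false b).
  rewrite (eq_card (B := [pred S | (S == set0) && accept (nth false b)])).
    case: (accept _); rewrite ?andbT.
      by rewrite (eq_card (B := pred1 set0)) ?card1 // => S; rewrite !inE ?andbT.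
    by rewrite eq_card0 // => S; rewrite !inE andbF.
  move=> S; rewrite !inE cards_eq0; case: eqP => [->|_]; last by rewrite andbF.
  have -> /= : (set0 : {set T}) \subset q by apply/subsetP => j; rewrite inE.
  apply: accept_ext => i; rewrite big1 ?addbF // => j.
  by rewrite inE.
elim: p k a => [|x p IHp] [|k] a; rewrite ?card0 //=.
  move=> _; apply: eq_card0 => S; rewrite !inE; apply/and3P => -[S0 Sk _].
  suff S00 : S = set0 by rewrite S00 cards0 in Sk.
  by apply/eqP; rewrite -subset0; apply: subset_trans S0 _; apply/subsetP.
move=> /andP[xp p_uniq]; rewrite -!IHp // -[LHS](cardsID [set S : {set T} | x \in S]).
congr (_ + _)%N; last first.
  apply: eq_card => S; rewrite !inE.
  have [xS|xS] /= := boolP (x \in S).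
    by case: (S \subset p) /subsetP => //= /(_ _ xS); rewrite (negPf xp).
  congr (_ && _); apply/subsetP/subsetP => sub y yS; move: (sub y yS).
    by rewrite inE => /predU1P[yx|//]; rewrite -yx yS in xS.
  by rewrite inE orbC => ->.
rewrite -[RHS](card_in_imset (f := fun S => x |: S)); last first.
  move=> S1 S2; rewrite !inE => /and3P[S1p _ _] /and3P[S2p _ _] /(congr1 (fun S : {set T} => S :\ x)).
  have xn (S : {set T}) : S \subset p -> (x |: S) :\ x = S.
    move=> /subsetP Sp; apply/setU1K/negP => /Sp xp'; by rewrite xp' in xp.
  by rewrite !xn.
apply: eq_card => S; rewrite !inE; apply/andP/imsetP => [[/and3P[Sp Sk Sa] xS]|].
  exists (S :\ x); rewrite ?setD1K // inE; apply/and3P; split.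
  - apply/subsetP => y; rewrite !inE => /andP[yx yS].
    by have := subsetP Sp y yS; rewrite inE (negPf yx).
  - by rewrite (cardsD1 x) xS in Sk.
  apply: etrans Sa; apply: accept_ext => i.
  by rewrite nth_seq_xor -addbA (big_setD1 x xS).
case=> S'; rewrite inE => /and3P[S'p S'k S'a] ->.
have xS' : x \notin S' by apply/negP => /(subsetP S'p); rewrite (negPf xp).
rewrite setU11; split=> //; apply/and3P; split.
- apply/subsetP => y; rewrite !inE => /predU1P[->|/(subsetP S'p)]; first by rewrite eqxx.
  by move=> yp; apply/orP; right.
- by rewrite cardsU1 xS'.
apply: etrans S'a; apply: accept_ext => i.
by rewrite nth_seq_xor -addbA big_setU1.
Qed.
End CountSubsets.

(** * Undetected errors *)

Definition undetected_syndrome (k s : nat) (f : nat -> bool) : bool :=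
  all (fun i => ~~ f i) (iota k s) && has f (iota 0 k).

Lemma undetected_syndrome_ext k s f g :
  f =1 g -> undetected_syndrome k s f = undetected_syndrome k s g.
Proof.
by move=> fg; congr (_ && _); [apply: eq_all => i; rewrite fg | apply: eq_has].
Qed.

Lemma natr_F2_addb (a b : bool) : (a (+) b)%:R = a%:R + b%:R :> 'F_2.
Proof. by apply/val_inj; case: a; case: b. Qed.

Lemma natr_F2_eq0 (b : bool) : (b%:R == 0 :> 'F_2) = ~~ b.
Proof. by case: b. Qed.

Lemma natr_F2_neq0 (x : 'F_2) : (x != 0)%:R = x.
Proof. by apply/val_inj; case: x => [[|[|]]]. Qed.

Lemma sum_F2_addb (I : Type) (r : seq I) (P : pred I) (b : I -> bool) :
  \sum_(i <- r | P i) (b i)%:R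
    = (\big[addb/false]_(i <- r | P i) b i)%:R :> 'F_2.
Proof. by rewrite (big_morph _ natr_F2_addb (erefl : (false%:R = 0 :> 'F_2))). Qed.

Section Columns.
Variables (k s n : nat) (G : 'M['F_2]_(k + s, n)) (c : 'I_n -> seq bool).
Hypothesis Gc : forall i j, G i j = (nth false (c j) i)%:R.

Let supp (e : 'rV['F_2]_n) : {set 'I_n} := [set j | e 0 j != 0].

Lemma syndrome_columns (e : 'rV['F_2]_n) i :
  (G *m e^T) i 0 = (\big[addb/false]_(j in supp e) nth false (c j) i)%:R.
Proof.
rewrite mxE -sum_F2_addb [RHS]big_mkcond; apply: eq_bigr => j _.
rewrite mxE Gc inE; case: eqP => [->|/eqP e0]; first by rewrite mulr0.
by rewrite -(natr_F2_neq0 (e 0 j)) e0 mulr1.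
Qed.

Lemma undetected_columns e :
  undetected G e = undetected_syndrome k s
    (fun i => \big[addb/false]_(j in supp e) nth false (c j) i).
Proof.
have Ge0 (i : 'I_(k + s)) : ((G *m e^T) i 0 == 0)
    = ~~ \big[addb/false]_(j in supp e) nth false (c j) i.
  by rewrite syndrome_columns natr_F2_eq0.
rewrite /undetected /undetected_syndrome mul_dsub_mx mul_usub_mx; congr (_ && _).
  apply/eqP/allP => [G0 i | G0].
    rewrite mem_iota => /andP[ki iks]; rewrite -(Ge0 (Ordinal iks)).
    have ik : (i - k < s)%N by rewrite ltn_subLR.
    have := congr1 (fun M : 'cV_s => M (Ordinal ik) 0) G0.
    rewrite /= mxE [RHS]mxE => <-; apply/eqP; congr (_ _ 0).
    by apply: val_inj; rewrite /= subnKC.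
  apply/matrixP => i j; rewrite ord1 [LHS]mxE [RHS]mxE; apply/eqP; rewrite Ge0.
  by apply: G0; rewrite mem_iota leq_addr ltn_add2l /=.
apply/idP/hasP => [G0 | [l]].
  have [i Gi] : exists i : 'I_k, usubmx (G *m e^T) i 0 != 0.
    apply/existsP; apply: contraNT G0; rewrite negb_exists => /forallP G0.
    apply/eqP/matrixP => i j; rewrite ord1 [RHS]mxE; apply/eqP.
    by have := G0 i; rewrite negbK.
  rewrite mxE Ge0 negbK in Gi; exists (val i) => //.
  by rewrite mem_iota /= ltn_ord.
rewrite mem_iota /= add0n => lk; apply: contraTneq => G0.
have := Ge0 (lshift s (Ordinal lk)) => /= <-.
have := congr1 (fun M : 'cV_k => M (Ordinal lk) 0) G0.
by rewrite /= mxE [RHS]mxE => ->.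
Qed.

(** A binary error is determined by its support: the cardinal of the support is the weight, and the
    sum of the columns it selects is the syndrome. *)
Lemma card_undetected (p : seq 'I_n) w :
  perm_eq p (enum 'I_n) ->
  #|[set e | undetected G e & wt e == w]|
    = count_subsets (undetected_syndrome k s) [seq c j | j <- p] w [::].
Proof.
move=> pE; rewrite -card_subsets; last first.
- by rewrite (perm_uniq pE) enum_uniq.
- exact: undetected_syndrome_ext.
have supp_bij : bijective supp.
  exists (fun S : {set 'I_n} => \row_j (j \in S)%:R) => [e | S].
    by apply/rowP => j; rewrite mxE inE natr_F2_neq0.
  by apply/setP => j; rewrite inE mxE natr_F2_eq0 negbK.
rewrite -(on_card_preimset (onW_bij _ supp_bij)); apply: eq_card => e.
rewrite !inE undetected_columns andbC /wt.
have -> : supp e \subset p.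
  by apply/subsetP => j _; rewrite (perm_mem pE) mem_enum.
congr (_ && _); apply: undetected_syndrome_ext => i.
by rewrite nth_nil.
Qed.

Lemma Zdistance_columns (p : seq 'I_n) d :
  perm_eq p (enum 'I_n) ->
  (forall w, (w < d)%N ->
    count_subsets (undetected_syndrome k s) [seq c j | j <- p] w [::] = 0%N) ->
  count_subsets (undetected_syndrome k s) [seq c j | j <- p] d [::] != 0%N ->
  Zdistance G d.
Proof.
move=> pE lt0; rewrite -card_undetected // => d0; split.
  have /set0Pn[e] : [set e | undetected G e & wt e == d] != set0.
    by rewrite -card_gt0 lt0n.
  by rewrite inE => /andP[Ge /eqP we]; exists e.
move=> e Ge; rewrite leqNgt; apply/negP => /lt0.
rewrite -card_undetected // => /cards0_eq/setP/(_ e).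
by rewrite !inE Ge eqxx.
Qed.
End Columns.

(** Stored in normal form, so that later evaluations start from literal bits and do not repeat the
    field arithmetic. *)
Definition code_columns : seq (seq bool) :=
  Eval vm_compute in [seq gf_column P | P <- gf_curve].

Lemma code_columnsE : [seq gf_column P | P <- gf_curve] = code_columns.
Proof. by vm_compute. Qed.

Lemma count_undetected_lt4 w : (w < 4)%N ->
  count_subsets (undetected_syndrome 6 9) code_columns w [::] = 0%N.
Proof. by case: w => [|[|[|[|]]]] // _; vm_compute. Qed.

Lemma count_undetected4 :
  count_subsets (undetected_syndrome 6 9) code_columns 4 [::] = 2720%N.
Proof. by vm_compute. Qed.

(** * Diagonal and linear Clifford operators *)

Section Operators.
Variable R : realType.
Local Notation C := R[i].

Definition sgn (x : 'F_2) : C := (-1) ^+ x.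

Lemma F2_cases (x : 'F_2) : x = 0 \/ x = 1.
Proof. by case: x => [[|[|//]] ?]; [left | right]; apply: val_inj. Qed.

Lemma sgnD x y : sgn (x + y) = sgn x * sgn y.
Proof.
have [->|->] := F2_cases x; first by rewrite add0r mul1r.
have [->|->] := F2_cases y; first by rewrite addr0 mulr1.
by rewrite /sgn /= expr1 mulrNN mulr1.
Qed.

Lemma conj_sgn x : (sgn x)^* = sgn x.
Proof. by rewrite rmorphXn rmorphN1. Qed.

Lemma sgn_sqr x : sgn x * sgn x = 1.
Proof. by have [->|->] := F2_cases x; rewrite /sgn ?mulr1 //= expr1 mulrNN mulr1. Qed.

Definition dot m (b z : 'rV['F_2]_m) : 'F_2 := \sum_i b 0 i * z 0 i.

Lemma dotDl m (a b z : 'rV['F_2]_m) : dot (a + b) z = dot a z + dot b z.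
Proof. by rewrite -big_split; apply: eq_bigr => i _; rewrite mxE mulrDl. Qed.

Lemma dot_delta m (i : 'I_m) x z : dot (x *: delta_mx 0 i) z = x * z 0 i.
Proof.
rewrite /dot (bigD1 i) //= big1 ?addr0; last first.
  by move=> j ji; rewrite !mxE (negPf ji) mulr0 mul0r.
by rewrite !mxE !eqxx mulr1.
Qed.

Lemma dot_mulmx m (A : 'M_m) (b z : 'rV['F_2]_m) : dot b (z *m A) = dot (b *m A^T) z.
Proof.
rewrite /dot; under eq_bigr do rewrite mxE mulr_sumr.
rewrite exchange_big; apply: eq_bigr => i _; rewrite mxE mulr_suml.
by apply: eq_bigr => j _; rewrite mxE; ring.
Qed.

Lemma pauliP m (P : op R m) :
  pauli P <-> exists (t : nat) (a b : 'rV['F_2]_m), forall i j,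
    P i j = 'i ^+ t * (enum_val i == enum_val j + a)%:R * sgn (dot b (enum_val j)).
Proof.
split=> -[t [a [b PE]]]; exists t, a, b.
  by move=> i j; rewrite PE mul_mx_diag !mxE mulrA.
by apply/matrixP => i j; rewrite PE mul_mx_diag !mxE mulrA.
Qed.

(** The multiplicative derivative of f in each direction a is, up to a power of i, a character of
    F_2^m. This is what makes the conjugate of X^a by [diag_op f] a Pauli operator. *)
Definition quadratic_phase m (f : 'rV['F_2]_m -> C) : Prop :=
  (forall z, f z * (f z)^* = 1) /\
  forall a, exists (t : nat) (b : 'rV['F_2]_m),
    forall z, f (z + a) = 'i ^+ t * sgn (dot b z) * f z.

Lemma diag_op_adjoint m (f : 'rV['F_2]_m -> C) :
  (diag_op f)^t* = diag_op (fun z => (f z)^*).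
Proof.
apply/matrixP => i j; rewrite !mxE eq_sym; case: eqP => [->|_] //=.
by rewrite !mulr0n rmorph0.
Qed.

Lemma diag_op_mul m (f g : 'rV['F_2]_m -> C) :
  diag_op f *m diag_op g = diag_op (fun z => f z * g z).
Proof. by rewrite mulmx_diag; congr diag_mx; apply/rowP => i; rewrite !mxE. Qed.

Lemma eq_diag_op m (f g : 'rV['F_2]_m -> C) : f =1 g -> diag_op f = diag_op g.
Proof. by move=> fg; congr diag_mx; apply/rowP => i; rewrite !mxE. Qed.

Lemma diag_op1 m : diag_op (fun _ => 1) = 1%:M :> op R m.
Proof. by apply/matrixP => i j; rewrite !mxE. Qed.

Lemma diag_op_unitary m (f : 'rV['F_2]_m -> C) :
  (forall z, f z * (f z)^* = 1) -> diag_op f \is unitarymx.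
Proof.
move=> f1; apply/unitarymxP; rewrite diag_op_adjoint diag_op_mul -diag_op1.
exact: eq_diag_op.
Qed.

Lemma quadratic_phase_clifford m (f : 'rV['F_2]_m -> C) :
  quadratic_phase f -> clifford (diag_op f).
Proof.
move=> [f1 fD]; split; first exact: diag_op_unitary.
move=> P /pauliP[t [a [b PE]]]; have [t' [b' fa]] := fD a.
apply/pauliP; exists (t + t')%N, a, (b + b') => i j.
rewrite diag_op_adjoint mul_mx_diag mul_diag_mx !mxE PE.
have [->|_] := eqVneq; last by rewrite !(mulr0, mul0r).
by rewrite fa dotDl sgnD exprD -[RHS]mulr1 -(f1 (enum_val j)); ring.
Qed.

Lemma quadratic_phaseM m (f g : 'rV['F_2]_m -> C) :
  quadratic_phase f -> quadratic_phase g -> quadratic_phase (fun z => f z * g z).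
Proof.
move=> [f1 fD] [g1 gD]; split=> [z | a].
  by rewrite rmorphM mulrACA f1 g1 mulr1.
have [t [b fa]] := fD a; have [t' [b' ga]] := gD a.
exists (t + t')%N, (b + b') => z; rewrite fa ga dotDl sgnD exprD; ring.
Qed.

Lemma eq_quadratic_phase m (f g : 'rV['F_2]_m -> C) :
  f =1 g -> quadratic_phase f -> quadratic_phase g.
Proof.
move=> fg [f1 fD]; split=> [z | a]; first by rewrite -fg.
by have [t [b fa]] := fD a; exists t, b => z; rewrite -!fg.
Qed.

Lemma quadratic_phase1 m : @quadratic_phase m (fun _ => 1).
Proof.
split=> [z | a]; first by rewrite rmorph1 mulr1.
by exists 0%N, 0 => z; rewrite /dot big1 ?mulr1 // => i _; rewrite mxE mul0r.
Qed.

Lemma quadratic_phaseX m (f : 'rV['F_2]_m -> C) n :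
  quadratic_phase f -> quadratic_phase (fun z => f z ^+ n).
Proof.
move=> qf; elim: n => [|n IHn].
  exact: eq_quadratic_phase (quadratic_phase1 m).
by apply: eq_quadratic_phase (quadratic_phaseM qf IHn) => z; rewrite exprS.
Qed.

Lemma quadratic_phase_S m (k : 'I_m) :
  quadratic_phase (fun z => 'i ^+ (z 0 k : 'F_2)).
Proof.
split=> [z | a]; first by rewrite rmorphXn /= -exprMn conjCi mulrN -expr2 sqrCi opprK expr1n.
(* For bits, i^(z + a mod 2) = i^a (-1)^(a z) i^z. *)
exists (a 0 k), (a 0 k *: delta_mx 0 k) => z; rewrite dot_delta mxE /sgn.
have [->|->] := F2_cases (a 0 k); have [->|->] := F2_cases (z 0 k);
  rewrite ?(addr0, add0r, mulr0, mul0r, mulr1, mul1r, expr0) //=.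
by rewrite !expr1 mulrN1 mulNr -expr2 sqrCi opprK.
Qed.

Lemma quadratic_phase_CZ m (k l : 'I_m) :
  quadratic_phase (fun z => sgn (z 0 k * z 0 l)).
Proof.
split=> [z | a]; first by rewrite conj_sgn sgn_sqr.
(* Expanding (z_k + a_k)(z_l + a_l), the constant a_k a_l gives the sign i^(2 a_k a_l) and the cross
   terms give the character. *)
exists (2 * (a 0 k * a 0 l : 'F_2)%R)%N, (a 0 k *: delta_mx 0 l + a 0 l *: delta_mx 0 k) => z.
rewrite dotDl !dot_delta !mxE exprM sqrCi -/(sgn _) -!sgnD; congr sgn; ring.
Qed.

(** For invertible A this is the permutation |z> -> |z A>, as realized by a CNOT circuit. *)
Definition linear_op m (A : 'M['F_2]_m) : op R m :=
  \matrix_(i, j) (enum_val i == enum_val j *m A)%:R.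

Lemma sum_enum_val (T : finType) (f : T -> C) (x : T) :
  \sum_(i < #|{: T}|) (enum_val i == x)%:R * f (enum_val i) = f x.
Proof.
rewrite (bigD1 (enum_rank x)) //= enum_rankK eqxx mul1r big1 ?addr0 // => i.
by rewrite -(inj_eq enum_val_inj) enum_rankK => /negPf->; rewrite mul0r.
Qed.

Section LinearOp.
Variables (m : nat) (A B : 'M['F_2]_m).
Hypothesis AB1 : A *m B = 1%:M.

Lemma linear_op_swap (x y : 'rV['F_2]_m) : (x == y *m A) = (y == x *m B).
Proof.
apply/eqP/eqP => ->; first by rewrite -mulmxA AB1 mulmx1.
by rewrite -mulmxA (mulmx1C AB1) mulmx1.
Qed.

Lemma linear_op_conjE (M : op R m) i j :
  (linear_op A *m M *m linear_op B) i j
    = M (enum_rank (enum_val i *m B)) (enum_rank (enum_val j *m B)).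
Proof.
pose N (y x : 'rV['F_2]_m) := M (enum_rank y) (enum_rank x).
have NE k l : M k l = N (enum_val k) (enum_val l) by rewrite /N !enum_valK.
rewrite mxE; under eq_bigr => l _ do rewrite [X in _ * X]mxE mulrC.
rewrite -/(N _ _) -(sum_enum_val (fun x => N (enum_val i *m B) x) (enum_val j *m B)).
apply: eq_bigr => l _; congr (_ * _); rewrite mxE.
rewrite -(sum_enum_val (fun y => N y (enum_val l)) (enum_val i *m B)).
by apply: eq_bigr => k _; rewrite mxE linear_op_swap NE.
Qed.

Lemma linear_op_adjoint : (linear_op A)^t* = linear_op B.
Proof.
by apply/matrixP => i j; rewrite !mxE linear_op_swap conjC_nat.
Qed.

Lemma linear_op_conj_diag (f : 'rV['F_2]_m -> C) :
  linear_op A *m diag_op f *m linear_op B = diag_op (fun z => f (z *m B)).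
Proof.
apply/matrixP => i j; rewrite linear_op_conjE !mxE enum_rankK.
rewrite (inj_eq enum_rank_inj) (can_eq (mulmxK _)) ?(inj_eq enum_val_inj) //.
by case: (mulmx1_unit AB1).
Qed.

(** Conjugation sends X^a Z^b to X^(a A) Z^(b B^T), where B is the inverse of A. *)
Lemma linear_op_clifford : clifford (linear_op A).
Proof.
split.
  apply/unitarymxP; rewrite linear_op_adjoint -[linear_op A]mulmx1 -diag_op1.
  by rewrite linear_op_conj_diag diag_op1.
move=> P /pauliP[t [a [b PE]]]; rewrite linear_op_adjoint.
apply/pauliP; exists t, (a *m A), (b *m B^T) => i j.
rewrite linear_op_conjE PE !enum_rankK dot_mulmx; congr (_ * _%:R * _).
by rewrite eq_sym -linear_op_swap mulmxDl -mulmxA (mulmx1C AB1) mulmx1.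
Qed.

End LinearOp.

Lemma tens_op_diag1 m1 m2 (f : 'rV['F_2]_m1 -> C) :
  tens_op (diag_op f) (1%:M : op R m2) = diag_op (fun z => f (lsubmx z)).
Proof.
apply/matrixP => i j; rewrite !mxE !enum_rankK !(inj_eq enum_rank_inj).
have [->|ij] := eqVneq i j; first by rewrite !eqxx mulr1.
have [l|_] := eqVneq; last by rewrite mulr0n mul0r.
have [r|_] := eqVneq; last by rewrite mulr0.
case/eqP: ij; apply: enum_val_inj.
by rewrite -[enum_val i]hsubmxK l r hsubmxK.
Qed.

Lemma CCZ_mul m (a b c d e f : 'I_m) :
  CCZ R a b c *m CCZ R d e f
    = diag_op (fun z => sgn (z 0 a * z 0 b * z 0 c + z 0 d * z 0 e * z 0 f)).
Proof. by rewrite diag_op_mul; apply: eq_diag_op => z; rewrite sgnD. Qed.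

Definition eighth (n : nat) : C := expi (pi / 4%:R * n%:R).

Lemma eighthD n k : eighth (n + k) = eighth n * eighth k.
Proof.
rewrite /eighth natrD mulrDr /expi cosD sinD; apply/eqP.
by rewrite eq_complex /= eqxx /= addrC.
Qed.

Lemma eighth0 : eighth 0 = 1.
Proof. by rewrite /eighth mulr0 /expi cos0 sin0. Qed.

Lemma eighth_mul n k : eighth (n * k) = eighth n ^+ k.
Proof.
by elim: k => [|k IHk]; rewrite ?muln0 ?eighth0 // mulnS eighthD IHk exprS.
Qed.

Lemma eighth2 : eighth 2 = 'i.
Proof.
rewrite /eighth -complexiE /expi (_ : pi / 4%:R * 2%:R = pi / 2%:R); last by field.
by rewrite cos_pihalf sin_pihalf.
Qed.

Lemma eighth4 : eighth 4 = -1.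
Proof. by rewrite (eighth_mul 2 2) eighth2 sqrCi. Qed.

Lemma eighth_mod n k : n = k %[mod 8] -> eighth n = eighth k.
Proof.
have e8 q : eighth q = eighth (q %% 8).
  rewrite {1}(divn_eq q 8) mulnC eighthD eighth_mul (eighth_mul 4 2) eighth4.
  by rewrite sqrrN !expr1n mul1r.
by move=> nk; rewrite e8 nk -e8.
Qed.

End Operators.

(** * Weights modulo 8 *)

(** Natural-number indices let monomials be plain lists of numbers, on which the parity tables can
    be evaluated. *)
Definition bit m (z : 'rV['F_2]_m) (a : nat) : bool :=
  if insub a is Some i then z 0 i != 0 else false.

Lemma bit_ord m (z : 'rV['F_2]_m) (i : 'I_m) : bit z i = (z 0 i != 0).
Proof. by rewrite /bit valK. Qed.

Lemma bitK m (z : 'rV['F_2]_m) (i : 'I_m) : z 0 i = (bit z i)%:R.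
Proof. by rewrite bit_ord natr_F2_neq0. Qed.

Lemma natr_F2_andb (a b : bool) : (a && b)%:R = a%:R * b%:R :> 'F_2.
Proof. by rewrite -mulnb natrM. Qed.

Lemma mulmx_bits m n (M : 'M['F_2]_(m, n)) (t : nat -> 'I_n -> bool) z j :
  (forall i j, M i j = (t i j)%:R) ->
  (z *m M) 0 j = (\big[addb/false]_(0 <= a < m) (bit z a && t a j))%:R.
Proof.
move=> Mt; rewrite mxE big_mkord -sum_F2_addb; apply: eq_bigr => i _.
by rewrite Mt bitK natr_F2_andb.
Qed.

Fixpoint subseqs_of_size (k : nat) (l : seq nat) : seq (seq nat) :=
  match k, l with
  | 0, _ => [:: [::]]
  | _.+1, [::] => [::]
  | k'.+1, x :: l' =>
      [seq x :: s | s <- subseqs_of_size k' l'] ++ subseqs_of_size k l'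
  end.

Lemma size_subseqs_of_size k l s : s \in subseqs_of_size k l -> size s = k.
Proof.
elim: l k s => [|x l IHl] [|k] s; rewrite ?inE ?mem_cat //=; try by move/eqP->.
by case/orP => [/mapP[s' /IHl <- ->] | /IHl].
Qed.

Definition elementary (k : nat) (l : seq nat) (b : nat -> bool) : nat :=
  \sum_(s <- subseqs_of_size k l) all b s.

(* This is (1 - (1 - 2)^N) / 2 = N - 2 'C(N, 2) + 4 'C(N, 3) - ..., mod 8, *)
(* where N is the number of bits that are set. *)
Lemma parity_mod8 (b : nat -> bool) (l : seq nat) :
  \big[addb/false]_(a <- l) b a
    = (elementary 1 l b + 6 * elementary 2 l b + 4 * elementary 3 l b)%N %[mod 8].
Proof.
have e0 r : elementary 0 r b = 1%N by case: r => *; rewrite /elementary /= big_seq1.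
have eS k x r : elementary k.+1 (x :: r) b
    = (b x * elementary k r b + elementary k.+1 r b)%N.
  rewrite /elementary /= big_cat big_map big_distrr /=; congr (_ + _)%N.
  by apply: eq_bigr => s _; rewrite mulnb.
elim: l => [|x l IHl]; first by rewrite /elementary !big_nil.
rewrite big_cons !eS e0; move: IHl.
move: (elementary 1 l b) (elementary 2 l b) (elementary 3 l b) => e1 e2 e3.
by case: (b x) (\big[addb/false]_(a <- l) b a) => -[] /=; lia.
Qed.

Section Weight.
Variables (m n : nat) (G : 'M['F_2]_(m, n)) (c : 'I_n -> seq bool) (p : seq 'I_n).
Hypothesis Gc : forall i j, G i j = (nth false (c j) i)%:R.
Hypothesis pE : perm_eq p (enum 'I_n).

Definition row_weight (cols : seq (seq bool)) (s : seq nat) : nat :=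
  count (fun v => all (nth false v) s) cols.

Definition weighted_elementary (cols : seq (seq bool)) k (b : nat -> bool) : nat :=
  \sum_(s <- subseqs_of_size k (iota 0 m)) all b s * row_weight cols s.

(** Each entry of [z *m G] is a parity, expanded by [parity_mod8]. Exchanging the sums over columns
    and monomials makes the coefficient of a monomial the number of columns where all its rows equal
    1. *)
Lemma wt_mod8 z :
  let E k := weighted_elementary [seq c j | j <- p] k (bit z) in
  wt (z *m G) = (E 1 + 6 * E 2 + 4 * E 3)%N %[mod 8].
Proof.
pose b j a := bit z a && nth false (c j) a.
have EE k : weighted_elementary [seq c j | j <- p] k (bit z)
    = (\sum_j elementary k (iota 0 m) (b j))%N.
  rewrite /elementary exchange_big; apply: eq_bigr => s _ /=.
  rewrite /row_weight -sum1_count big_map (perm_big _ pE) big_enum_cond /=.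
  rewrite big_mkcond big_distrr /=; apply: eq_bigr => j _.
  by rewrite /b all_predI; do 2 case: all.
rewrite /= !EE !big_distrr -!big_split /= /wt -sum1_card big_mkcond.
apply: (big_ind2 (fun x y => x = y %[mod 8])) => // [x1 x2 y1 y2 xx yy|j _].
  by rewrite /= -modnDm xx yy modnDm.
rewrite -parity_mod8 inE (mulmx_bits (t := fun a j => nth false (c j) a)) //.
by rewrite natr_F2_eq0 negbK /index_iota subn0; case: (\big[_/_]_(_ <- _) _).
Qed.
End Weight.

Arguments row_weight : simpl never.

(** * Exponents that contribute only S and CZ gates *)

Section Phases.
Variables (R : realType) (m : nat).
Local Notation eighth := (eighth R).

Lemma quadratic_phase_sum (I : eqType) (r : seq I) (h : I -> 'rV['F_2]_m -> nat) :
  (forall i, i \in r -> quadratic_phase (fun z => eighth (h i z))) ->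
  quadratic_phase (fun z => eighth (\sum_(i <- r) h i z)).
Proof.
elim: r => [|i r IHr] hr.
  by apply: eq_quadratic_phase (quadratic_phase1 R m) => z; rewrite big_nil eighth0.
have qi := hr i (mem_head i r).
have /IHr qr : forall j, j \in r -> quadratic_phase (fun z => eighth (h j z)).
  by move=> j jr; apply: hr; rewrite inE jr orbT.
apply: eq_quadratic_phase (quadratic_phaseM qi qr) => z.
by rewrite big_cons eighthD.
Qed.

Lemma quadratic_phase_bit n a :
  quadratic_phase (fun z : 'rV_m => eighth (2 * n * bit z a)).
Proof.
rewrite /bit; case: insubP => [i _ _ | _]; last first.
  by apply: eq_quadratic_phase (quadratic_phase1 R m) => z; rewrite muln0 eighth0.
apply: eq_quadratic_phase (quadratic_phaseX n (quadratic_phase_S R i)) => z.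
rewrite -mulnA eighth_mul eighth2 mulnC exprM.
by have [->|->] := F2_cases (z 0 i).
Qed.

Lemma quadratic_phase_bit2 n a1 a2 :
  quadratic_phase (fun z : 'rV_m => eighth (4 * n * (bit z a1 && bit z a2))).
Proof.
have q1 : quadratic_phase (fun z : 'rV_m => eighth (4 * n * false)).
  by apply: eq_quadratic_phase (quadratic_phase1 R m) => z; rewrite muln0 eighth0.
rewrite /bit; case: insubP => [i _ _ | _]; last exact: q1.
case: insubP => [j _ _ | _]; last first.
  by apply: eq_quadratic_phase q1 => z; rewrite andbF.
apply: eq_quadratic_phase (quadratic_phaseX n (quadratic_phase_CZ R i j)) => z.
rewrite -mulnA eighth_mul eighth4 mulnC exprM /sgn.
by have [->|->] := F2_cases (z 0 i); have [->|->] := F2_cases (z 0 j).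
Qed.

End Phases.

(** * Normal form of the cubic phase *)

Definition bool_mx (t : seq bitseq) m n : 'M['F_2]_(m, n) :=
  \matrix_(i, j) (nth false (nth [::] t i) j)%:R.

(* The rows of the inverse matrix span the two 3-dimensional subspaces of     *)
(* vectors whose contraction with the trilinear form has rank 2.              *)
Definition normal_form_rows : seq bitseq :=
  map (map (fun n => n == 1))
  [:: [:: 1; 0; 0; 0; 0; 0]; [:: 0; 0; 0; 1; 0; 0]; [:: 0; 0; 1; 0; 0; 1];
      [:: 0; 1; 0; 0; 1; 0]; [:: 0; 1; 1; 0; 0; 1]; [:: 0; 1; 0; 0; 1; 1]]%N.

Definition normal_form_inv_rows : seq bitseq :=
  map (map (fun n => n == 1))
  [:: [:: 1; 0; 0; 0; 0; 0]; [:: 0; 0; 1; 0; 1; 0]; [:: 0; 0; 1; 1; 0; 1];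
      [:: 0; 1; 0; 0; 0; 0]; [:: 0; 0; 1; 1; 1; 0]; [:: 0; 0; 0; 1; 0; 1]]%N.

Definition normal_form_mx : 'M['F_2]_6 := bool_mx normal_form_rows 6 6.

Definition normal_form_inv_mx : 'M['F_2]_6 := bool_mx normal_form_inv_rows 6 6.

Lemma normal_form_mxK : normal_form_inv_mx *m normal_form_mx = 1%:M.
Proof.
apply/matrixP => i k; rewrite mxE.
under eq_bigr => j _ do rewrite !mxE -natr_F2_andb.
rewrite sum_F2_addb mxE !big_ord_recl big_ord0 /=; congr (_%:R).
by case: i => [[|[|[|[|[|[|//]]]]]] ?]; case: k => [[|[|[|[|[|[|//]]]]]] ?].
Qed.

(** * Finite checks on the 64 columns *)

Fixpoint seq_dot (u v : seq bool) : bool :=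
  match u, v with
  | a :: u', b :: v' => (a && b) (+) seq_dot u' v'
  | _, _ => false
  end.

Lemma seq_dotE u v :
  seq_dot u v = \big[addb/false]_(0 <= i < size u) (nth false u i && nth false v i).
Proof.
rewrite big_mkord; elim: u v => [|a u IHu] v; first by rewrite big_ord0.
rewrite /= big_ord_recl; case: v => [|b v] /=; last by rewrite IHu.
by rewrite andbF big1 // => i _; rewrite andbF.
Qed.

Fixpoint bitseqs (n : nat) : seq bitseq :=
  if n is n'.+1 then [seq b :: s | b <- [:: true; false], s <- bitseqs n']
  else [:: [::]].

Lemma mem_bitseqs s : s \in bitseqs (size s).
Proof.
elim: s => [|b s IHs] //=; rewrite cats0 mem_cat.
by case: b; rewrite map_f ?orbT.
Qed.

Lemma code_columns_separate :
  all (fun z => ~~ has id z || has (seq_dot z) code_columns) (bitseqs 15).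
Proof. by vm_compute. Qed.

Definition row_weights_even (k : nat) : bool :=
  all (fun s => ~~ odd (row_weight code_columns s)) (subseqs_of_size k (iota 0 15)).

Lemma row_weights1_even : row_weights_even 1.
Proof. by vm_compute. Qed.

Lemma row_weights2_even : row_weights_even 2.
Proof. by vm_compute. Qed.

(** All indices are below 6, so the cubic phase does not see the stabilizer bits; this is why the
    non-Clifford factor has the form [V] tensor identity. *)
Lemma row_weights3_odd :
  [seq s <- subseqs_of_size 3 (iota 0 15) | odd (row_weight code_columns s)]
  = [:: [:: 0; 2; 3]; [:: 0; 2; 4]; [:: 0; 2; 5]; [:: 0; 3; 4]; [:: 0; 4; 5];
        [:: 1; 2; 3]; [:: 1; 2; 5]; [:: 1; 3; 4]; [:: 1; 3; 5]; [:: 1; 4; 5]]%N.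
Proof. by vm_compute. Qed.

Definition CCZ2_exponent (y : 'rV['F_2]_6) : 'F_2 :=
  let i k : 'I_6 := inord k in
  y 0 (i 0) * y 0 (i 1) * y 0 (i 2) + y 0 (i 3) * y 0 (i 4) * y 0 (i 5).

(** Expanding the products of linear forms in z gives the ten odd triples together with monomials
    having a repeated variable. Since a bit equals its square, the latter drop to degree 2, and z0
    z4 + z1 z5 is what survives. *)
Lemma cubic_normal_form (z : 'rV['F_2]_(6 + 9)) :
  odd (weighted_elementary 15 code_columns 3 (bit z))
    (+) (CCZ2_exponent (lsubmx z *m normal_form_mx) != 0)
  = (bit z 0 && bit z 4) (+) (bit z 1 && bit z 5).
Proof.
pose t := fun a (j : 'I_6) => nth false (nth [::] normal_form_rows a) j.
have bz a : (a < 6)%N -> bit (lsubmx z) a = bit z a.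
  move=> a6; rewrite (bit_ord _ (Ordinal a6)) mxE.
  by rewrite -(bit_ord z (lshift 9 (Ordinal a6))).
have yE (k : 'I_6) : (lsubmx z *m normal_form_mx) 0 k
    = (\big[addb/false]_(0 <= a < 6) (bit z a && t a k))%:R.
  rewrite (mulmx_bits (t := t)); last by move=> i j; rewrite mxE.
  by congr ((nat_of_bool _)%:R); apply: eq_big_nat => a /andP[_ a6]; rewrite bz.
rewrite /CCZ2_exponent !yE -!natr_F2_andb -natr_F2_addb natr_F2_eq0 negbK.
rewrite /t !inordK // /weighted_elementary (big_morph odd oddD (erefl _)).
rewrite (eq_bigr (fun s => if odd (row_weight code_columns s) then all (bit z) s else false));
  last by move=> s _; rewrite oddM oddb; case: odd; rewrite ?andbT ?andbF.
rewrite -big_mkcond -big_filter row_weights3_odd /index_iota /=.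
rewrite !big_cons !big_nil /=.
by case: (bit z 0) (bit z 1) (bit z 2) (bit z 3) (bit z 4) (bit z 5) => -[] [] [] [] [].
Qed.

Lemma phase_exponent_mod8 (e1 e2 e3 w : nat) (g q q' : bool) :
  w = (e1 + 6 * e2 + 4 * e3)%N %[mod 8] -> odd e3 (+) g = q (+) q' ->
  (e1 + 6 * e2 + (4 * q + 4 * q') = w + 4 * g %[mod 8])%N.
Proof. by case: g q q' => [] [] [] /=; lia. Qed.

(** * Independence of the rows and the Clifford correction *)

Section Main.
Variables (n : nat) (G : 'M['F_2]_(6 + 9, n)) (c : 'I_n -> seq bool) (p : seq 'I_n).
Hypothesis Gc : forall i j, G i j = (nth false (c j) i)%:R.
Hypothesis pE : perm_eq p (enum 'I_n).
Hypothesis pc : [seq c j | j <- p] = code_columns.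

Lemma code_row_free : row_free G.
Proof.
apply: inj_row_free => z zG0; apply/eqP/contraT => z0.
pose u := mkseq (bit z) 15.
have su : size u = 15%N by rewrite size_mkseq.
have := allP code_columns_separate u; rewrite -{1}su mem_bitseqs => /(_ isT).
have -> : has id u.
  have /existsP[i zi] : [exists i, z 0 i != 0].
    apply: contraNT z0; rewrite negb_exists => /forallP zi.
    by apply/eqP/rowP => i; rewrite mxE; apply/eqP; have := zi i; rewrite negbK.
  apply/hasP; exists true => //; apply/mapP; exists (val i).
    by rewrite mem_iota ltn_ord.
  by rewrite bit_ord zi.
rewrite -pc has_map => /hasP[j _ ucj].
have {ucj} : seq_dot u (c j) := ucj; rewrite seq_dotE su.
have := congr1 (fun v : 'rV_n => v 0 j) zG0.
rewrite (mulmx_bits (t := fun a j => nth false (c j) a)) // mxE => /eqP.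
rewrite natr_F2_eq0 => /negPf zj.
rewrite (eq_big_nat _ _ (F2 := fun a => bit z a && nth false (c j) a)) ?zj //.
by move=> a /andP[_ a15]; rewrite nth_mkseq.
Qed.

Variable R : realType.

Let cubic (z : 'rV['F_2]_6) : R[i] := sgn R (CCZ2_exponent (z *m normal_form_mx)).

(** [cubic] takes values 1 and -1, so multiplying by it divides it out: the cubic terms cancel
    modulo 8, leaving even linear terms, quadratic terms divisible by 4, and two CZ phases. *)
Lemma correction_quadratic : quadratic_phase (fun z =>
  expi (pi / 4%:R * (wt (z *m G))%:R) * cubic (lsubmx z)).
Proof.
pose E k (z : 'rV['F_2]_(6 + 9)) := weighted_elementary 15 code_columns k (bit z).
have q1 : quadratic_phase (fun z : 'rV_(6 + 9) => eighth R (E 1 z)).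
  apply: quadratic_phase_sum => s sl.
  have /negPf s_even := allP row_weights1_even s sl.
  case: s sl s_even => [|a [|? ?]] /size_subseqs_of_size //= _ s_even.
  apply: eq_quadratic_phase (quadratic_phase_bit R (6 + 9) (row_weight code_columns [:: a])./2 a).
  move=> z; congr eighth; rewrite andbT mulnC; congr muln.
  by rewrite -[RHS]odd_double_half s_even add0n mul2n.
have q2 : quadratic_phase (fun z : 'rV_(6 + 9) => eighth R (6 * E 2 z)).
  apply: (eq_quadratic_phase (f := fun z => eighth R (\sum_(s <- subseqs_of_size 2 (iota 0 15))
    6 * (all (bit z) s * row_weight code_columns s)))).
    by move=> z; rewrite /E /weighted_elementary big_distrr.
  apply: quadratic_phase_sum => s sl.
  have /negPf s_even := allP row_weights2_even s sl.
  case: s sl s_even => [|a [|b [|? ?]]] /size_subseqs_of_size //= _ s_even.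
  (* With an even weight w = 2 h, the coefficient 6 w equals 4 (3 h), so the term is a power of
     CZ. *)
  apply: eq_quadratic_phase (quadratic_phase_bit2 R (6 + 9)
    (3 * (row_weight code_columns [:: a; b])./2) a b).
  move=> z; congr eighth; rewrite andbT; have := odd_double_half (row_weight code_columns [:: a; b]).
  rewrite s_even add0n -mul2n; move: (row_weight _ _) => w; move: w./2 => h <-.
  ring.
pose q (z : 'rV['F_2]_(6 + 9)) : nat := bit z 0 && bit z 4.
pose q' (z : 'rV['F_2]_(6 + 9)) : nat := bit z 1 && bit z 5.
have q3 : quadratic_phase (fun z : 'rV_(6 + 9) => eighth R (4 * q z + 4 * q' z)).
  apply: eq_quadratic_phase (quadratic_phaseM (quadratic_phase_bit2 R (6 + 9) 1 0 4)
    (quadratic_phase_bit2 R (6 + 9) 1 1 5)) => z.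
  by rewrite eighthD !muln1.
apply: eq_quadratic_phase (quadratic_phaseM (quadratic_phaseM q1 q2) q3) => z.
pose g : nat := (CCZ2_exponent (lsubmx z *m normal_form_mx) != 0).
have -> : cubic (lsubmx z) = eighth R (4 * g).
  rewrite eighth_mul eighth4 /cubic /g /sgn.
  by have [->|->] := F2_cases (CCZ2_exponent (lsubmx z *m normal_form_mx)).
rewrite -[expi _]/(eighth R _) -!eighthD; apply: eighth_mod.
apply: phase_exponent_mod8 (cubic_normal_form z).
by have := wt_mod8 Gc pE z; rewrite pc.
Qed.
End Main.

Unset Implicit Arguments.

Theorem mainTheorem19 (R : realType) (F : fieldExtType 'F_2)
    (alpha : finvect_type F) :
  \dim {: F} = 4%N ->
  alpha ^+ 4 = alpha + 1 ->
  let G := code_matrix alpha in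
  [/\ #|curve F| = 64%N,
      self_dual_basis (beta alpha),
      row_free G
      /\ (exists (C : op R (6 + 9)) (V : op R 6),
           [/\ is_diag_mx C,
               clifford C,
               V \is unitarymx,
               induced_T R G = C *m tens_op V (1%:M : op R 9)
             & exists a b c d e f : 'I_6,
                 uniq [:: a; b; c; d; e; f]
                 /\ clifford_equiv V (CCZ R a b c *m CCZ R d e f)])
    & Zdistance G 4
      /\ #|[set v | undetected G v & wt v == 4%N]| = 2720%N].
Proof.
move=> dimF alphaE G.
have [p pE [c pc Gc]] := code_matrix_columns dimF alphaE.
rewrite code_columnsE in pc.
split.
- exact: card_curve dimF alphaE.
- exact: beta_self_dual dimF alphaE.
- split; first exact: code_row_free Gc pc.
  pose v (z : 'rV['F_2]_6) := sgn R (CCZ2_exponent (z *m normal_form_mx)).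
  have v1 z : v z * (v z)^* = 1 by rewrite conj_sgn sgn_sqr.
  (* [C] is [D_G] times the inverse of [V] tensor identity; [v] is its own inverse. *)
  exists (diag_op (fun z => expi (pi / 4%:R * (wt (z *m G))%:R) * v (lsubmx z))).
  exists (diag_op v); split.
  + exact: diag_mx_is_diag.
  + exact/quadratic_phase_clifford/(correction_quadratic Gc pE pc R).
  + exact: diag_op_unitary.
  + rewrite tens_op_diag1 diag_op_mul; apply: eq_diag_op => z.
    by rewrite -[RHS]mulrA /v sgn_sqr mulr1.
  (* Conjugating the CCZ phase by the change of basis substitutes [z *m normal_form_mx] for its
     argument, which gives [v]. *)
  + exists (inord 0), (inord 1), (inord 2), (inord 3), (inord 4), (inord 5).
    split; first by rewrite /= !inE -!val_eqE /= !inordK.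
    exists (linear_op R normal_form_inv_mx), (linear_op R normal_form_mx); split.
    * exact: linear_op_clifford normal_form_mxK.
    * exact: linear_op_clifford (mulmx1C normal_form_mxK).
    * by rewrite CCZ_mul linear_op_conj_diag ?normal_form_mxK.
- split; last by rewrite (card_undetected Gc 4 pE) pc count_undetected4.
  apply: (Zdistance_columns Gc pE); rewrite pc ?count_undetected4 //.
  exact: count_undetected_lt4.
Qed.
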